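(* Let $V$ be a finite set, $f \colon 2^V \to \mathbb{R}$ submodular, $S \subseteq V$, and $g \colon 2^V \to \mathbb{R}$ given by $g(X) = f(X \vartriangle S)$. Then for $T \subseteq V$, the function $h(X) = g(X \vartriangle T)$ is submodular if and only if $M_g \boldsymbol{\chi}_T \equiv \mathbf{b}_g \pmod 2$, where $\boldsymbol{\chi}_T$ is the characteristic vector of $T$.
   Context: A set function on $2^V$ is submodular if $h(X)+h(Y) \ge h(X \cup Y) + h(X \cap Y)$ for all $X,Y \subseteq V$ (no normalization assumed). $X \vartriangle S$ is the symmetric difference. $\mathcal{P} = \{ (Z,\{u,v\}) : Z \subseteq V,\ u,v \in V \setminus Z,\ u \ne v\}$, and for a set function $g$, $\check{\Phi}_g(Z,\{u,v\}) = g(Z \cup \{u\}) + g(Z \cup \{v\}) - g(Z \cup \{u,v\}) - g(Z)$. $M_g$ is the $0$-$1$ matrix with rows indexed by $\mathcal{P}$ and columns by $V$ whose $(Z,\{u,v\})$-row is the characteristic row vector of $\{u,v\}$ if $\check{\Phi}_g(Z,\{u,v\}) \neq 0$ and zero otherwise. $\mathbf{b}_g \in \{0,1\}^{\mathcal{P}}$ has $\mathbf{b}_g[(Z,\{u,v\})] = 0$ if $\check{\Phi}_g(Z,\{u,v\}) \ge 0$ and $1$ otherwise. *)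

(* Defs.v *)
From mathcomp Require Import all_boot all_order all_algebra.
From mathcomp Require Import reals.

Set Implicit Arguments.
Unset Strict Implicit.
Unset Printing Implicit Defensive.

Import GRing.Theory Num.Theory.
Local Open Scope ring_scope.

Definition symdiff (V : finType) (A B : {set V}) : {set V} :=
  (A :\: B) :|: (B :\: A).

Definition submodular (R : realType) (V : finType) (h : {set V} -> R) : Prop :=
  forall X Y : {set V}, h (X :|: Y) + h (X :&: Y) <= h X + h Y.

(* The unordered pair {u, v} is encoded as the two-element set [set u; v]. *)
Definition isP (V : finType) (p : {set V} * {set V}) : bool :=
  [exists u, exists v,
     [&& u \notin p.1, v \notin p.1, u != v & p.2 == [set u; v]]].

Definition PP (V : finType) : finType := {p : {set V} * {set V} | isP p}.

(* The sum over w in {u, v} makes the definition independent of an ordering of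
   the pair; Phi_set2 below gives the expanded form. *)
Definition Phi (R : realType) (V : finType) (g : {set V} -> R)
    (Z e : {set V}) : R :=
  \sum_(w in e) g (Z :|: [set w]) - g (Z :|: e) - g Z.

Lemma Phi_set2 (R : realType) (V : finType) (g : {set V} -> R)
    (Z : {set V}) (u v : V) : u != v ->
  Phi g Z [set u; v] =
    g (Z :|: [set u]) + g (Z :|: [set v]) - g (Z :|: [set u; v]) - g Z.
Proof. by move=> uv; rewrite /Phi big_setU1 ?inE //= big_set1. Qed.

(* Rows and columns are numbered by the canonical enumerations of PP V and V. *)
Definition Mmx (R : realType) (V : finType) (g : {set V} -> R) :
    'M[int]_(#|PP V|, #|V|) :=
  \matrix_(i, j)
    let: (Z, e) := val (enum_val i) in
    if Phi g Z e != 0 then (enum_val j \in e)%:R else 0.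

Definition bvec (R : realType) (V : finType) (g : {set V} -> R) :
    'cV[int]_#|PP V| :=
  \col_i let: (Z, e) := val (enum_val i) in if 0 <= Phi g Z e then 0 else 1.

Definition chi (V : finType) (T : {set V}) : 'cV[int]_#|V| :=
  \col_j (enum_val j \in T)%:R.

Definition eqmod2 (n : nat) (x y : 'cV[int]_n) : Prop :=
  forall i, (x i ord0 = y i ord0 %[mod 2])%Z.

(* Main.v *)
(* Submodularity is a local condition: h is submodular iff Phi h Z {u, v} >= 0
   for every Z and every pair u <> v outside Z. Indeed, the inequality
   h(A + C + E) + h(A) <= h(A + C) + h(A + E), required for all A, is preserved
   when C is replaced by a union of such sets, and it is symmetric in C and E.
   The map X |-> symdiff X T sends the square {Z, Z + u, Z + v, Z + u + v} to
   the square based at (symdiff Z T) \ {u, v}, reversing the sign of Phi exactly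
   when T separates u from v. Hence submodularity of h says that
   (-1)^|T :&: {u, v}| has the sign of Phi g Z {u, v} wherever the latter is
   nonzero, which is the row (Z, {u, v}) of the linear system mod 2. *)
Require Import Defs.
From mathcomp Require Import all_boot all_order all_algebra.
From mathcomp Require Import reals.
From mathcomp Require Import lra.

Set Implicit Arguments.
Unset Strict Implicit.
Unset Printing Implicit Defensive.

Import Order.TTheory GRing.Theory Num.Theory.
Local Open Scope ring_scope.

(** No disjointness of [A] from [C] and [E] is asked, so that [A] can absorb part of [C] in an
    induction. *)
Definition submodular_along (R : realType) (V : finType) (h : {set V} -> R)
    (C E : {set V}) : Prop :=
  forall A : {set V}, h (A :|: C :|: E) + h A <= h (A :|: C) + h (A :|: E).

Lemma submodular_alongC (R : realType) (V : finType) (h : {set V} -> R)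
    (C E : {set V}) : submodular_along h C E -> submodular_along h E C.
Proof. by move=> hCE A; rewrite setUAC [leRHS]addrC. Qed.

Lemma submodular_along_set1 (R : realType) (V : finType) (h : {set V} -> R)
    (C E : {set V}) :
  (forall c, c \in C -> submodular_along h [set c] E) -> submodular_along h C E.
Proof.
move=> hC; have -> : C = \bigcup_(c in C) [set c].
  apply/setP=> x; apply/idP/bigcupP => [xC|[c cC /set1P->] //].
  by exists x; rewrite ?inE.
elim/big_ind: _ => [A|C1 C2 h1 h2 A|//]; first by rewrite setU0 addrC.
(* Adding the two inequalities cancels [h (A :|: C1)] and [h (A :|: C1 :|: E)]. *)
have := h1 A; have := h2 (A :|: C1); rewrite -!setUA.
by lra.
Qed.

Lemma submodularP (R : realType) (V : finType) (h : {set V} -> R) :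
  submodular h <->
  (forall (Z : {set V}) (u v : V),
    u \notin Z -> v \notin Z -> u != v -> 0 <= Phi h Z [set u; v]).
Proof.
split=> [hS Z u v uZ vZ uv|hP X Y].
  have := hS (Z :|: [set u]) (Z :|: [set v]).
  rewrite -setUIr -setUUr (_ : [set u] :&: [set v] = set0) ?setU0; last first.
    by apply/setP=> x; rewrite !inE; case: eqP => // ->; apply/negbTE.
  by rewrite Phi_set2 //; lra.
have h2 u v : u != v -> submodular_along h [set u] [set v].
  (* If [A] contains [u] or [v], the inequality degenerates to an equality. *)
  move=> uv A; have [uA|uA] := boolP (u \in A).
    by rewrite (setUidPl (_ : [set u] \subset A)) ?sub1set // addrC.
  have [vA|vA] := boolP (v \in A).
    by rewrite setUAC (setUidPl (_ : [set v] \subset A)) ?sub1set.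
  by have := hP A u v uA vA uv; rewrite Phi_set2 // setUA; lra.
have hXY : submodular_along h (X :\: Y) (Y :\: X).
  apply: submodular_along_set1 => u /setDP[_ uY].
  apply: submodular_alongC; apply: submodular_along_set1 => v /setDP[vY _].
  by apply: h2; apply: contraNneq uY => <-.
have := hXY (X :&: Y); rewrite setID setDE setUIr setUCr setIT.
by rewrite -setDE [X :&: Y in W in _ <= _ + W]setIC setID.
Qed.

Lemma Phi_symdiff (R : realType) (V : finType) (g : {set V} -> R)
    (T Z : {set V}) (u v : V) : u \notin Z -> v \notin Z -> u != v ->
  Phi (fun X => g (symdiff X T)) Z [set u; v] =
  (-1) ^+ ((u \in T) + (v \in T)) *
    Phi g (symdiff Z T :\: [set u; v]) [set u; v].
Proof.
move=> uZ vZ uv; rewrite !Phi_set2 //; set W := _ :\: _.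
have vu : (v == u) = false by rewrite eq_sym (negbTE uv).
(* Since [Z] misses the pair, the shift by [T] splits: outside the pair it gives [W], the same for
   all four corners, and on the pair it acts on [D] alone. *)
have E (D : {set V}) : D \subset [set u; v] ->
    symdiff (Z :|: D) T = W :|: symdiff D (T :&: [set u; v]).
  move/subsetP=> sD; apply/setP=> x; have := sD x; rewrite !inE.
  case: (x =P u) => [->|_]; first by rewrite (negbTE uZ); do 2!case: (_ \in _).
  case: (x =P v) => [->|_]; first by rewrite (negbTE vZ); do 2!case: (_ \in _).
  by case: (x \in D) => [/(_ isT)//|_]; do 2!case: (_ \in _).
have E0 := E set0 (sub0set _); rewrite setU0 in E0.
rewrite E0 !E ?sub0set ?sub1set ?inE ?eqxx ?orbT //.
have F (D D' : {set V}) : D \subset [set u; v] -> D' \subset [set u; v] ->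
    (u \in D) (+) (u \in T) = (u \in D') ->
    (v \in D) (+) (v \in T) = (v \in D') ->
    symdiff D (T :&: [set u; v]) = D'.
  move=> /subsetP sD /subsetP sD' Du Dv; apply/setP=> x.
  have := sD x; have := sD' x; rewrite !inE.
  case: (x =P u) => [->|_]; first by rewrite -Du; do 2!case: (_ \in _).
  case: (x =P v) => [->|_]; first by rewrite -Dv; do 2!case: (_ \in _).
  case: (x \in D) => [_ /(_ isT)//|].
  by case: (x \in D') => [/(_ isT)//|_ _]; rewrite !andbF.
have s0 : set0 \subset [set u; v] by exact: sub0set.
have su : [set u] \subset [set u; v] by rewrite sub1set !inE eqxx.
have sv : [set v] \subset [set u; v] by rewrite sub1set !inE eqxx orbT.
have s2 := subxx [set u; v].
(* The shift permutes the corners of the square. It swaps opposite corners if [T] contains both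
   points, swaps adjacent corners, of opposite sign in [Phi], if it contains exactly one, and fixes
   all corners otherwise. *)
case uT: (u \in T); case vT: (v \in T) => /=.
- rewrite (F set0 [set u; v]) ?(F [set u] [set v]) ?(F [set v] [set u])
    ?(F [set u; v] set0) ?inE ?eqxx ?vu ?(negbTE uv) ?uT ?vT // setU0.
  by lra.
- rewrite (F set0 [set u]) ?(F [set u] set0) ?(F [set v] [set u; v])
    ?(F [set u; v] [set v]) ?inE ?eqxx ?vu ?(negbTE uv) ?uT ?vT // setU0.
  by lra.
- rewrite (F set0 [set v]) ?(F [set u] [set u; v]) ?(F [set v] set0)
    ?(F [set u; v] [set u]) ?inE ?eqxx ?vu ?(negbTE uv) ?uT ?vT // setU0.
  by lra.
- rewrite (F set0 set0) ?(F [set u] [set u]) ?(F [set v] [set v])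
    ?(F [set u; v] [set u; v]) ?inE ?eqxx ?vu ?(negbTE uv) ?uT ?vT // setU0.
  by lra.
Qed.

(** The map on base points of squares is an involution, so every square of [g] comes from one of the
    shifted function. *)
Lemma symdiff_setDK (V : finType) (T Z e : {set V}) :
  [disjoint Z & e] -> symdiff (symdiff Z T :\: e) T :\: e = Z.
Proof.
move=> /pred0P Ze; apply/setP=> x; have /= := Ze x; rewrite !inE.
by do 3!case: (_ \in _).
Qed.

Lemma submodular_symdiffP (R : realType) (V : finType) (g : {set V} -> R)
    (T : {set V}) :
  submodular (fun X => g (symdiff X T)) <->
  (forall (Z : {set V}) (u v : V),
    u \notin Z -> v \notin Z -> u != v ->
    0 <= (-1) ^+ ((u \in T) + (v \in T)) * Phi g Z [set u; v]).
Proof.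
rewrite submodularP; split=> hP Z u v uZ vZ uv; last first.
  by rewrite Phi_symdiff //; apply: hP; rewrite // !inE eqxx ?orbT.
have Ze : [disjoint Z & [set u; v]].
  by rewrite disjoint_sym disjoints_subset subUset !sub1set !inE uZ.
rewrite -[X in Phi g X](symdiff_setDK T Ze) -Phi_symdiff //.
  by apply: hP; rewrite // !inE eqxx ?orbT.
all: by rewrite !inE eqxx ?orbT.
Qed.

Lemma Mmx_chi (R : realType) (V : finType) (g : {set V} -> R) (T : {set V})
    (i : 'I_#|PP V|) (Z : {set V}) (u v : V) :
  u != v -> val (enum_val i) = (Z, [set u; v]) ->
  (Mmx g *m chi T) i ord0 =
  if Phi g Z [set u; v] != 0 then ((u \in T) + (v \in T))%:R else 0.
Proof.
move=> uv iE; rewrite mxE.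
under eq_bigr => j _ do rewrite !mxE iE.
case: ifP => _; last by rewrite big1 // => j _; rewrite mul0r.
rewrite -(big_enum_val (fun w => (w \in [set u; v])%:R * (w \in T)%:R)) /=.
rewrite natrD (bigD1 u) //= (bigD1 v) ?inE 1?eq_sym //= !eqxx orbT !mul1r.
rewrite big1 ?addr0 // => w /andP[wu wv].
by rewrite !inE (negbTE wu) (negbTE wv) mul0r.
Qed.

(** Here [n] counts the points of the pair in [T], which leaves three cases. At [x = 0] both sides
    hold, as the row and the entry of [bvec] vanish. *)
Lemma sign_eqmod2 (R : realType) (n : nat) (x : R) : (n <= 2)%N ->
  0 <= (-1) ^+ n * x <->
  ((if x != 0 then n%:R else 0 : int)%R =
   (if 0 <= x then 0 else 1 : int)%R %[mod 2])%Z.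
Proof.
case: (ltgtP x 0) => [x0|x0|->]; case: n => [|[|[|//]]] _;
  rewrite ?expr0 ?expr1 ?sqrrN ?expr1n ?mul1r ?mulN1r ?mulr0;
  split=> //; first [lra | move=> ?; exfalso; lra].
Qed.

Theorem theorem4p1 (R : realType) (V : finType) (f : {set V} -> R)
    (S T : {set V}) (f_submod : submodular f) :
  let g := fun X : {set V} => f (symdiff X S) in
  let h := fun X : {set V} => g (symdiff X T) in
  submodular h <-> eqmod2 (Mmx g *m chi T) (bvec g).
Proof.
move=> g h; rewrite /h submodular_symdiffP.
have n2 (u v : V) : ((u \in T) + (v \in T) <= 2)%N by do 2!case: (_ \in _).
split=> [hP i|hP Z u v uZ vZ uv].
  case iE: (val (enum_val i)) => [Z e].
  have := valP (enum_val i); rewrite iE => /existsP[u /existsP[v]].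
  case/and4P=> /= uZ vZ uv /eqP eE; rewrite {}eE in iE.
  by rewrite (Mmx_chi g T uv iE) mxE iE; apply/sign_eqmod2; last exact: hP.
(* Conversely, each [Z], [u], [v] indexes a row, where the congruence gives the sign. *)
have pP : isP (Z, [set u; v]).
  by apply/existsP; exists u; apply/existsP; exists v; rewrite /= uZ vZ uv /=.
pose i := enum_rank (Sub (Z, [set u; v]) pP : PP V).
have iE : val (enum_val i) = (Z, [set u; v]) by rewrite enum_rankK.
have := hP i; rewrite (Mmx_chi g T uv iE) mxE iE.
by move=> /(sign_eqmod2 _ (n2 u v)).
Qed.
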